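(* Let $m\ge n$, let $A\in\mathbb{R}^{m\times m}$, $B\in\mathbb{R}^{n\times n}$, $C\in\mathbb{R}^{m\times n}$, where $A$ and $B$ have no common eigenvalue, and suppose that the solution $X\in\mathbb{R}^{m\times n}$ of the Sylvester equation $AX-XB=C$ has full rank. Then $$n\le\kappa_F(X)\le\frac{n}{2}\left(\kappa_2(X)+\frac{1}{\kappa_2(X)}\right).$$
   Context: $X^+$ denotes the Moore--Penrose pseudoinverse; $\kappa_F(X)=\|X\|_F\|X^+\|_F$ with $\|\cdot\|_F$ the Frobenius norm, and $\kappa_2(X)=\|X\|_2\|X^+\|_2$ with $\|\cdot\|_2$ the spectral norm (so $\kappa_2(X)=\sigma_1(X)/\sigma_n(X)$ when $X$ has full column rank $n$). *)

(* Defs.v *)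
From HB Require Import structures.
From mathcomp Require Import all_boot all_order all_algebra.
From mathcomp Require Import complex.
From mathcomp Require Import mathcomp_extra boolp classical_sets reals.

Set Implicit Arguments.
Unset Strict Implicit.
Unset Printing Implicit Defensive.

Import Order.TTheory GRing.Theory Num.Theory.
Local Open Scope classical_set_scope.
Local Open Scope ring_scope.

(* On a column vector this is the Euclidean norm. *)
Definition frobenius_norm (R : realType) (m n : nat) (X : 'M[R]_(m, n)) : R :=
  Num.sqrt (\sum_i \sum_j X i j ^+ 2).

(* Operator norm for the Euclidean norms.  The unit ball rather than the unit
   sphere is used so that the supremum is over a nonempty set when n = 0. *)
Definition spectral_norm (R : realType) (m n : nat) (X : 'M[R]_(m, n)) : R :=
  sup [set frobenius_norm (X *m v) |
        v in [set v : 'cV[R]_n | frobenius_norm v <= 1]].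

Definition is_pseudoinverse (R : realType) (m n : nat)
    (X : 'M[R]_(m, n)) (Y : 'M[R]_(n, m)) : Prop :=
  [/\ X *m Y *m X = X,
      Y *m X *m Y = Y,
      (X *m Y)^T = X *m Y
    & (Y *m X)^T = Y *m X].

(* [pinvmx] of mxalgebra is only some one-sided partial inverse and does not
   satisfy the Penrose equations in general.  The default value 0 is never
   used: see [pseudoinverseP] and [pseudoinverse_uniq]. *)
Definition pseudoinverse (R : realType) (m n : nat) (X : 'M[R]_(m, n)) :
    'M[R]_(n, m) :=
  xget 0 [set Y | is_pseudoinverse X Y].

Definition kappaF (R : realType) (m n : nat) (X : 'M[R]_(m, n)) : R :=
  frobenius_norm X * frobenius_norm (pseudoinverse X).

Definition kappa2 (R : realType) (m n : nat) (X : 'M[R]_(m, n)) : R :=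
  spectral_norm X * spectral_norm (pseudoinverse X).

(* Eigenvalues of a real matrix are taken in the complex numbers. *)
Definition complex_eigenvalue (R : realType) (n : nat) (A : 'M[R]_n)
    (z : R[i]) : bool :=
  eigenvalue (map_mx (real_complex R) A) z.

Lemma spectral_norm_has_sup (R : realType) (m n : nat) (X : 'M[R]_(m, n)) :
  has_sup [set frobenius_norm (X *m v) |
            v in [set v : 'cV[R]_n | frobenius_norm v <= 1]].
Proof.
split.
  exists (frobenius_norm (X *m (0 : 'cV[R]_n))), 0 => //=.
  rewrite /frobenius_norm big1 ?sqrtr0 ?ler01// => i _.
  by rewrite big1// => j _; rewrite mxE expr0n.
exists (Num.sqrt (\sum_(i < m) (\sum_(j < n) `|X i j|) ^+ 2)) => _ [v /= v1 <-].
have vj j : `|v j 0| <= 1.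
  apply: le_trans v1; rewrite -sqrtr_sqr; apply: ler_wsqrtr.
  rewrite (bigD1 j)//= (big_ord1 _ (fun k => v j k ^+ 2)) lerDl.
  by apply: sumr_ge0 => i _; apply: sumr_ge0 => k _; apply: sqr_ge0.
apply: ler_wsqrtr; apply: ler_sum => i _; rewrite big_ord1 -real_normK ?num_real//.
rewrite ler_sqr ?nnegrE ?normr_ge0 ?sumr_ge0// mxE.
apply: (le_trans (ler_norm_sum _ _ _)); apply: ler_sum => j _.
by rewrite normrM ler_piMr.
Qed.

Lemma gram_unitmx (R : realType) (m n : nat) (X : 'M[R]_(m, n)) :
  row_free X -> X *m X^T \in unitmx.
Proof.
move=> fX; rewrite -row_free_unit; apply: inj_row_free => v.
rewrite mulmxA => vXX; have vX : v *m X = 0.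
  have : (v *m X) *m (v *m X)^T = 0 by rewrite trmx_mul mulmxA vXX mul0mx.
  move: (v *m X) => w /(congr1 (fun M : 'M[R]_1 => M 0 0)).
  rewrite !mxE => /eqP.
  rewrite psumr_eq0 => [/allP z|k _]; last by rewrite mxE -expr2 sqr_ge0.
  apply/rowP => k; have := z k (mem_index_enum _).
  by rewrite mxE -expr2 sqrf_eq0 => /eqP ->; rewrite mxE.
by apply: (row_free_inj fX); rewrite vX mul0mx.
Qed.

Lemma pseudoinverse_exists (R : realType) (m n : nat) (X : 'M[R]_(m, n)) :
  exists Y, is_pseudoinverse X Y.
Proof.
have uD : row_base X *m (row_base X)^T \in unitmx.
  exact/gram_unitmx/row_base_free.
have uC : (col_base X)^T *m col_base X \in unitmx.
  rewrite -{2}(trmxK (col_base X)); apply: gram_unitmx.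
  by rewrite /row_free mxrank_tr; have := col_base_full X; rewrite /row_full.
move: (col_base X) (row_base X) (mulmx_base X) uD uC.
move: (\rank X) => r C D <- uD uC.
set P := invmx (D *m D^T); set Q := invmx (C^T *m C).
have PT : P^T = P by rewrite trmx_inv trmx_mul trmxK.
have QT : Q^T = Q by rewrite trmx_inv trmx_mul trmxK.
have XY : C *m D *m (D^T *m P *m Q *m C^T) = C *m Q *m C^T.
  by rewrite !mulmxA -(mulmxA C D) -(mulmxA C _ P) mulmxV// mulmx1.
have YX : (D^T *m P *m Q *m C^T) *m (C *m D) = D^T *m P *m D.
  by rewrite !mulmxA -(mulmxA _ C^T C) -(mulmxA _ Q) mulVmx// mulmx1.
exists (D^T *m P *m Q *m C^T); split.
- by rewrite XY !mulmxA -(mulmxA _ C^T C) -(mulmxA C Q) mulVmx// mulmx1.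
- rewrite YX !mulmxA -(mulmxA _ D D^T) -(mulmxA _ (D *m D^T) P).
  by rewrite mulmxV// mulmx1.
- by rewrite XY !trmx_mul trmxK QT mulmxA.
- by rewrite YX !trmx_mul trmxK PT mulmxA.
Qed.

Lemma pseudoinverseP (R : realType) (m n : nat) (X : 'M[R]_(m, n)) :
  is_pseudoinverse X (pseudoinverse X).
Proof. exact: (xgetPex 0 (pseudoinverse_exists X)). Qed.

Lemma pseudoinverse_uniq (R : realType) (m n : nat) (X : 'M[R]_(m, n))
    (Y : 'M[R]_(n, m)) :
  is_pseudoinverse X Y -> pseudoinverse X = Y.
Proof.
move: (pseudoinverse X) (pseudoinverseP X) => Z [z1 z2 z3 z4] [y1 y2 y3 y4].
have XZY : X *m Z = X *m Y.
  by rewrite -z3 -{1}y1 -(mulmxA (X *m Y)) trmx_mul z3 y3 mulmxA z1.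
have ZYX : Z *m X = Y *m X.
  by rewrite -z4 -{1}y1 -(mulmxA X) mulmxA trmx_mul z4 y4 -mulmxA
             (mulmxA X Z) z1.
by rewrite -z2 -mulmxA XZY mulmxA ZYX y2.
Qed.

(* Main.v *)
Require Import Defs.
From HB Require Import structures.
From mathcomp Require Import all_boot all_order all_algebra.
From mathcomp Require Import complex ring lra.
From mathcomp Require Import mathcomp_extra boolp classical_sets reals.

Set Implicit Arguments.
Unset Strict Implicit.
Unset Printing Implicit Defensive.

Import Order.TTheory GRing.Theory Num.Theory.
Local Open Scope ring_scope.

(** Only the full rank of [X] matters.  Then [Y := pseudoinverse X] satisfies
    [Y X = 1], and the lower bound is Cauchy-Schwarz for the trace form applied
    to [tr (Y X) = n].  With [M] and [N] the spectral norms of [X] and [Y], the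
    matrices [M^2 - X^T X] and [N^2 - Y Y^T] are positive semidefinite, and
    [Y Y^T] is the inverse of [X^T X]; nonnegativity of the trace of their
    product reads [M^2 |Y|_F^2 + N^2 |X|_F^2 <= n (M^2 N^2 + 1)], and AM-GM on
    the left-hand side gives the upper bound (Kantorovich's inequality).  The
    trace of a product of positive semidefinite matrices is handled by symmetric
    elimination, without the spectral theorem. *)

(** Symmetry is part of the definition because over the reals a nonnegative quadratic form does not
    force it. *)
Definition psdmx (R : realType) (n : nat) (P : 'M[R]_n) : Prop :=
  P^T = P /\ forall v : 'rV[R]_n, 0 <= (v *m P *m v^T) 0 0.

(** * The Frobenius norm as a trace form *)

Lemma sqr_frobenius_norm (R : realType) (m n : nat) (X : 'M[R]_(m, n)) :
  frobenius_norm X ^+ 2 = \tr (X *m X^T).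
Proof.
rewrite sqr_sqrtr; last first.
  by apply: sumr_ge0 => i _; apply: sumr_ge0 => j _; apply: sqr_ge0.
apply: eq_bigr => i _; rewrite mxE; apply: eq_bigr => j _.
by rewrite mxE expr2.
Qed.

Lemma frobenius_norm_ge0 (R : realType) (m n : nat) (X : 'M[R]_(m, n)) :
  0 <= frobenius_norm X.
Proof. exact: sqrtr_ge0. Qed.

Lemma mxtrace_mul_tr_ge0 (R : realType) (m n : nat) (X : 'M[R]_(m, n)) :
  0 <= \tr (X *m X^T).
Proof. by rewrite -sqr_frobenius_norm sqr_ge0. Qed.

(** Combined with nonnegativity of the left-hand side, this yields Cauchy-Schwarz for suitable [a]
    and [b]. *)
Lemma mxtrace_mul_trB (R : realType) (m n : nat) (a b : R) (X Y : 'M[R]_(m, n)) :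
  \tr ((a *: X - b *: Y) *m (a *: X - b *: Y)^T) =
  a ^+ 2 * \tr (X *m X^T) - 2 * a * b * \tr (X *m Y^T) +
  b ^+ 2 * \tr (Y *m Y^T).
Proof.
have YX : \tr (Y *m X^T) = \tr (X *m Y^T).
  by rewrite -mxtrace_tr trmx_mul trmxK.
rewrite [(_ - _)^T]linearB /= ![(_ *: _)^T]linearZ /= mulmxBl !mulmxBr.
rewrite -!scalemxAl -!scalemxAr !linearB /= !mxtraceZ YX; ring.
Qed.

Lemma mxtrace_mul_tr_eq0 (R : realType) (m n : nat) (X : 'M[R]_(m, n)) :
  \tr (X *m X^T) = 0 -> X = 0.
Proof.
move/eqP; rewrite psumr_eq0 => [/allP X0|i _]; last first.
  by rewrite mxE; apply: sumr_ge0 => j _; rewrite mxE -expr2 sqr_ge0.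
apply/matrixP => i j; have := X0 i (mem_index_enum _); rewrite /= mxE.
rewrite psumr_eq0 => [/allP Xi0|k _]; last by rewrite mxE -expr2 sqr_ge0.
by have := Xi0 j (mem_index_enum _); rewrite /= !mxE -expr2 sqrf_eq0 => /eqP.
Qed.

Lemma frobenius_normZ (R : realType) (m n : nat) (a : R) (X : 'M[R]_(m, n)) :
  0 <= a -> frobenius_norm (a *: X) = a * frobenius_norm X.
Proof.
move=> a0; apply: (@pexpIrn _ 2) => //; rewrite ?nnegrE ?mulr_ge0 ?frobenius_norm_ge0 //.
rewrite exprMn !sqr_frobenius_norm linearZ /= -scalemxAl -scalemxAr.
by rewrite scalerA mxtraceZ expr2.
Qed.

(** * The spectral norm and semidefinite Gram matrices *)

Lemma spectral_norm_ge0 (R : realType) (m n : nat) (X : 'M[R]_(m, n)) :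
  0 <= spectral_norm X.
Proof.
apply: (@le_trans _ _ (frobenius_norm (X *m (0 : 'cV_n)))).
  exact: frobenius_norm_ge0.
apply: (sup_upper_bound (spectral_norm_has_sup X)); exists 0 => //=.
by rewrite -(scale0r (0 : 'cV_n)) frobenius_normZ // mul0r ler01.
Qed.

Lemma frobenius_norm_mulmx_le (R : realType) (m n : nat) (X : 'M[R]_(m, n))
    (v : 'cV[R]_n) :
  frobenius_norm (X *m v) <= spectral_norm X * frobenius_norm v.
Proof.
have [v0|v0] := eqVneq (frobenius_norm v) 0.
  have -> : v = 0 by apply: mxtrace_mul_tr_eq0; rewrite -sqr_frobenius_norm v0 expr0n.
  by rewrite mulmx0 -[0 in leLHS](scale0r (0 : 'cV_m)) frobenius_normZ // mul0r
             mulr_ge0 ?spectral_norm_ge0 ?frobenius_norm_ge0.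
have vp : 0 < frobenius_norm v by rewrite lt_def v0 frobenius_norm_ge0.
have vi : 0 <= (frobenius_norm v)^-1 by rewrite invr_ge0 ltW.
rewrite -ler_pdivrMr // mulrC -frobenius_normZ // scalemxAr.
apply: (sup_upper_bound (spectral_norm_has_sup X)).
exists ((frobenius_norm v)^-1 *: v) => //=.
by rewrite frobenius_normZ // mulVf.
Qed.

Lemma mxtrace_mulmx_tr_le (R : realType) (m n : nat) (X : 'M[R]_(m, n))
    (v : 'cV[R]_n) :
  \tr (X *m v *m (X *m v)^T) <= spectral_norm X ^+ 2 * \tr (v *m v^T).
Proof.
rewrite -!sqr_frobenius_norm -exprMn ler_sqr ?frobenius_norm_mulmx_le //.
  by rewrite nnegrE frobenius_norm_ge0.
by rewrite nnegrE mulr_ge0 ?spectral_norm_ge0 ?frobenius_norm_ge0.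
Qed.

Lemma form_mxtrace (R : realType) (n : nat) (P : 'M[R]_n) (v : 'rV[R]_n) :
  (v *m P *m v^T) 0 0 = \tr (v *m P *m v^T).
Proof. by rewrite trace_mx11. Qed.

Lemma psdmx_spectral_norm_gram (R : realType) (m n : nat) (X : 'M[R]_(m, n)) :
  psdmx ((spectral_norm X ^+ 2)%:M - X^T *m X).
Proof.
split; first by rewrite linearB /= tr_scalar_mx trmx_mul trmxK.
move=> v; rewrite form_mxtrace mulmxBr mulmxBl linearB /= subr_ge0.
rewrite mul_mx_scalar -scalemxAl mxtraceZ.
have := mxtrace_mulmx_tr_le X v^T; rewrite trmxK (mxtrace_mulC v^T).
by rewrite trmx_mul trmxK (mxtrace_mulC (X *m _)) !mulmxA.
Qed.

(* The bound must be moved from [Y] to [Y^T]; this is done by expanding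
   [0 <= |Y Y^T v - c v|^2] with [c = spectral_norm Y ^+ 2]. *)
Lemma psdmx_spectral_norm_cogram (R : realType) (m n : nat) (Y : 'M[R]_(n, m)) :
  0 < spectral_norm Y -> psdmx ((spectral_norm Y ^+ 2)%:M - Y *m Y^T).
Proof.
move=> Y0; split; first by rewrite linearB /= tr_scalar_mx trmx_mul trmxK.
move=> v; rewrite form_mxtrace mulmxBr mulmxBl linearB /=.
rewrite mul_mx_scalar -scalemxAl mxtraceZ.
have := mxtrace_mulmx_tr_le Y (Y^T *m v^T).
have := mxtrace_mul_tr_ge0 (1 *: (v *m Y *m Y^T) - spectral_norm Y ^+ 2 *: v).
rewrite mxtrace_mul_trB.
set c := spectral_norm Y ^+ 2; have c0 : 0 < c by rewrite exprn_gt0.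
have <- : \tr (v *m Y *m (v *m Y)^T) = \tr (Y^T *m v^T *m (Y^T *m v^T)^T).
  by rewrite mxtrace_mulC !trmx_mul !trmxK.
have <- : \tr (v *m Y *m Y^T *m (v *m Y *m Y^T)^T) =
  \tr (Y *m (Y^T *m v^T) *m (Y *m (Y^T *m v^T))^T).
  by rewrite mxtrace_mulC !trmx_mul !trmxK !mulmxA.
have -> : \tr (v *m (Y *m Y^T) *m v^T) = \tr (v *m Y *m (v *m Y)^T).
  by rewrite trmx_mul !mulmxA.
have -> : \tr (v *m Y *m Y^T *m v^T) = \tr (v *m Y *m (v *m Y)^T).
  by rewrite trmx_mul !mulmxA.
move: (\tr (v *m Y *m (v *m Y)^T)) (\tr (_ *m _)) (\tr (v *m v^T)) => s q t h1 h2.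
rewrite -(pmulr_rge0 _ c0); lra.
Qed.

(** * Symmetric elimination on semidefinite matrices *)

Lemma form_deltaE (R : realType) (n : nat) (P : 'M[R]_n) (v : 'rV[R]_n) (i : 'I_n) :
  ((delta_mx 0 i : 'rV_n) *m P *m v^T) 0 0 = (row i P *m v^T) 0 0.
Proof. by rewrite -rowE. Qed.

Lemma form_delta_delta (R : realType) (n : nat) (P : 'M[R]_n) (i j : 'I_n) :
  ((delta_mx 0 i : 'rV_n) *m P *m (delta_mx 0 j : 'rV_n)^T) 0 0 = P i j.
Proof. by rewrite form_deltaE trmx_delta -colE !mxE. Qed.

Lemma sym_formD (R : realType) (n : nat) (P : 'M[R]_n) (a : R) (u v : 'rV[R]_n) :
  P^T = P ->
  ((a *: u + v) *m P *m (a *: u + v)^T) 0 0 =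
  a ^+ 2 * (u *m P *m u^T) 0 0 + 2 * a * (u *m P *m v^T) 0 0 +
  (v *m P *m v^T) 0 0.
Proof.
move=> PT.
have vu : v *m P *m u^T = u *m P *m v^T.
  apply/rowP => k; rewrite ord1 -[in LHS](trmxK (v *m P *m u^T)) mxE.
  by rewrite !trmx_mul PT trmxK mulmxA.
rewrite [(_ + _)^T]linearD /= [(_ *: _)^T]linearZ /= !mulmxDl !mulmxDr.
by rewrite -!scalemxAl -!scalemxAr vu !mxE; ring.
Qed.

Lemma psdmx_diag_ge0 (R : realType) (n : nat) (P : 'M[R]_n) (i : 'I_n) :
  psdmx P -> 0 <= P i i.
Proof. by case=> _ /(_ (delta_mx 0 i)); rewrite form_delta_delta. Qed.

Lemma psdmx_diag0 (R : realType) (n : nat) (P : 'M[R]_n) :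
  psdmx P -> (forall i, P i i = 0) -> P = 0.
Proof.
move=> [PT P0] Pd; apply/matrixP => i j; rewrite mxE.
(* With zero diagonal, the form takes the values [2 * P i j] and [- 2 * P i j] at these two vectors,
   so both are nonnegative. *)
have := P0 (1 *: delta_mx 0 i + delta_mx 0 j).
have := P0 ((-1) *: delta_mx 0 i + delta_mx 0 j).
by rewrite !sym_formD // !form_delta_delta !Pd; lra.
Qed.

(** This is the Schur complement of the pivot [P i i]: its form at [v] is the minimum of the form of
    [P] over [v] plus multiples of the [i]-th basis vector. *)
Lemma psdmx_elim (R : realType) (n : nat) (P : 'M[R]_n) (i : 'I_n) :
  psdmx P -> 0 < P i i -> psdmx (P - (P i i)^-1 *: ((row i P)^T *m row i P)).
Proof.
move=> [PT P0] Pi; split.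
  by rewrite linearB /= linearZ /= trmx_mul trmxK PT.
move=> v; pose b := (row i P *m v^T) 0 0.
(* The coefficient [- (b / P i i)] is the minimiser. *)
have := P0 ((- (b / P i i)) *: delta_mx 0 i + v).
rewrite sym_formD // form_delta_delta form_deltaE -/b mulmxBr mulmxBl.
rewrite -scalemxAr -scalemxAl.
have -> : v *m ((row i P)^T *m row i P) *m v^T = (b * b)%:M.
  rewrite mulmxA -mulmxA -[v *m _]trmxK trmx_mul trmxK.
  by rewrite [_ *m v^T]mx11_scalar -/b tr_scalar_mx -scalar_mxM.
move: (v *m P *m v^T) => q; rewrite !mxE mulr1n; congr (0 <= _).
by field; rewrite gt_eqF.
Qed.

(* Rank-one elimination on a positive diagonal entry of [P] strictly increases
   the number of zeros on the diagonal. *)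
Lemma mxtrace_psdmx_mul_ge0 (R : realType) (n : nat) (P Q : 'M[R]_n) :
  psdmx P -> psdmx Q -> 0 <= \tr (P *m Q).
Proof.
move=> Ppsd Qpsd.
have [k] := ubnP #|[pred i | P i i != 0]|.
elim: k P Ppsd => // k IHk P Ppsd; rewrite ltnS => Pk.
have [i /= Pi|Pd] := pickP [pred i | P i i != 0]; last first.
  rewrite (psdmx_diag0 Ppsd) ?mul0mx ?linear0 // => i.
  by have /negbFE/eqP := Pd i.
have {}Pi : 0 < P i i by rewrite lt_def Pi psdmx_diag_ge0.
have P'psd := psdmx_elim Ppsd Pi.
set w := row i P in P'psd; set P' := P - _ in P'psd.
have -> : P = P' + (P i i)^-1 *: (w^T *m w) by rewrite subrK.
rewrite mulmxDl linearD /= addr_ge0 //.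
  apply: IHk => //; apply: leq_trans Pk.
  apply: proper_card; apply/properP; split.
    (* A zero diagonal entry stays zero: elimination subtracts a nonnegative number from it, and
       [P'] is still semidefinite. *)
    apply/fintype.subsetP => j; rewrite !inE; apply: contraNN => /eqP Pj.
    rewrite eq_le psdmx_diag_ge0 // andbT /P' !mxE big_ord1 Pj sub0r oppr_le0.
    by rewrite !mxE -expr2 mulr_ge0 ?sqr_ge0 // invr_ge0 ltW.
  exists i; first by rewrite !inE gt_eqF.
  rewrite !inE negbK /P' !mxE big_ord1 !mxE.
  by rewrite mulKf ?subrr // gt_eqF.
(* By cyclicity the rank-one part contributes the form of [Q] at [w], divided by the pivot. *)
rewrite -scalemxAl mxtraceZ mulr_ge0 ?invr_ge0 ?(ltW Pi) // -mulmxA mxtrace_mulC.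
by rewrite -form_mxtrace; apply: Qpsd.2.
Qed.

(** * The two bounds on the condition number *)

Lemma pseudoinverse_mulVmx (R : realType) (m n : nat) (X : 'M[R]_(m, n)) :
  row_full X -> pseudoinverse X *m X = 1%:M.
Proof.
(* The left inverse [L] cancels the leading [X] in [X Y X = X]. *)
move=> /row_fullP[L LX]; have [XYX _ _ _] := pseudoinverseP X.
by rewrite -[LHS]mul1mx -LX -mulmxA (mulmxA X) XYX.
Qed.

Lemma kappaF_ge (R : realType) (m n : nat) (X : 'M[R]_(m, n)) :
  row_full X -> n%:R <= kappaF X.
Proof.
move=> /pseudoinverse_mulVmx; rewrite /kappaF; set Y := pseudoinverse X => YX.
set x := frobenius_norm X; set y := frobenius_norm Y.
have x0 : 0 <= x by exact: frobenius_norm_ge0.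
have y0 : 0 <= y by exact: frobenius_norm_ge0.
have [xy0|xy0] := eqVneq (x * y) 0.
  suff : 1%:M = 0 :> 'M[R]_n.
    by move=> /(congr1 mxtrace); rewrite mxtrace1 linear0 xy0 => ->.
  rewrite -YX; move/eqP: xy0; rewrite mulf_eq0 => /orP[]/eqP z.
    by rewrite [X]mxtrace_mul_tr_eq0 ?mulmx0 // -sqr_frobenius_norm -/x z expr0n.
  by rewrite [Y]mxtrace_mul_tr_eq0 ?mul0mx // -sqr_frobenius_norm -/y z expr0n.
have {xy0} xyp : 0 < x * y by rewrite lt_def xy0 mulr_ge0.
(* Since [\tr (X *m Y) = n], this square expands to [2 * (x * y) * (x * y - n)]. *)
have := mxtrace_mul_tr_ge0 (y *: X - x *: Y^T).
rewrite mxtrace_mul_trB trmxK -sqr_frobenius_norm -/x (mxtrace_mulC X) YX mxtrace1.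
rewrite (mxtrace_mulC Y^T) -sqr_frobenius_norm -/y => h.
rewrite -(ler_pM2l xyp); lra.
Qed.

Lemma kappaF_le (R : realType) (m n : nat) (X : 'M[R]_(m, n)) :
  row_full X -> kappaF X <= n%:R / 2 * (kappa2 X + (kappa2 X)^-1).
Proof.
(* For [n = 0] both sides vanish; otherwise a basis vector is available to show [M * N] nonzero. *)
case: n X => [|n] X.
  by rewrite /kappaF /frobenius_norm big1 ?sqrtr0 ?mul0r // => i _; rewrite big_ord0.
move=> /pseudoinverse_mulVmx; rewrite /kappaF /kappa2; set Y := pseudoinverse X => YX.
set M := spectral_norm X; set N := spectral_norm Y.
have M0 : 0 <= M by exact: spectral_norm_ge0.
have N0 : 0 <= N by exact: spectral_norm_ge0.
have MN : 0 < M * N.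
  rewrite lt_def mulr_ge0 // andbT; apply/eqP => MN0.
  (* As [Y X = 1], the basis vector has norm at most [M * N] times itself, so [M * N = 0] would make
     it vanish. *)
  have := frobenius_norm_mulmx_le Y (X *m delta_mx 0 0).
  rewrite mulmxA YX mul1mx -/N => h.
  have := le_trans h (ler_wpM2l N0 (frobenius_norm_mulmx_le X (delta_mx 0 0))).
  rewrite -/M mulrA (mulrC N) MN0 mul0r => {}h.
  have /eqP : frobenius_norm (delta_mx 0 0 : 'cV[R]_n.+1) = 0.
    by apply/eqP; rewrite eq_le h frobenius_norm_ge0.
  rewrite -sqrf_eq0 sqr_frobenius_norm => /eqP/mxtrace_mul_tr_eq0/matrixP/(_ 0 0).
  by rewrite !mxE => /eqP; rewrite oner_eq0.
have Np : 0 < N.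
  rewrite lt_def N0 andbT.
  by apply: contraTneq MN => ->; rewrite mulr0 ltxx.
have := mxtrace_psdmx_mul_ge0 (psdmx_spectral_norm_gram X)
  (psdmx_spectral_norm_cogram Np).
rewrite -/M -/N.
have XY : X^T *m X *m (Y *m Y^T) = 1%:M.
  (* Symmetry of [X Y] turns the product into the transpose of [Y X Y X]. *)
  have [_ _ XYT _] := pseudoinverseP X.
  by rewrite mulmxA -(mulmxA X^T) -XYT -!trmx_mul !mulmxA YX mul1mx YX trmx1.
rewrite mulmxBl !mulmxBr XY -scalar_mxM mul_mx_scalar mul_scalar_mx.
rewrite !linearB /= !mxtraceZ mxtrace_scalar mxtrace1.
rewrite -(sqr_frobenius_norm Y) (mxtrace_mulC X^T) -(sqr_frobenius_norm X).
set x := frobenius_norm X; set y := frobenius_norm Y => h.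
(* AM-GM: [2 * M * N * x * y] is at most the sum of squares bounded in [h]. *)
have h2 := sqr_ge0 (M * y - N * x).
rewrite -(ler_pM2l MN).
have -> : M * N * (n.+1%:R / 2 * (M * N + (M * N)^-1)) = n.+1%:R / 2 * ((M * N) ^+ 2 + 1).
  by rewrite mulrCA mulrDr -expr2 mulfV ?gt_eqF.
move: h; rewrite -[_ *+ _]mulr_natr; move: n.+1%:R => r h. lra.
Qed.

Theorem mainTheorem6 (R : realType) (m n : nat) (hmn : (n <= m)%N)
    (A : 'M[R]_m) (B : 'M[R]_n) (C X : 'M[R]_(m, n))
    (hAB : ~ exists z : R[i], complex_eigenvalue A z /\ complex_eigenvalue B z)
    (hX : A *m X - X *m B = C)
    (hrank : \rank X = minn m n) :
  n%:R <= kappaF X /\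
  kappaF X <= n%:R / 2 * (kappa2 X + (kappa2 X)^-1).
Proof.
have fX : row_full X by rewrite /row_full hrank (minn_idPr hmn).
by split; [exact: kappaF_ge | exact: kappaF_le].
Qed.
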